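(* For every even integer $p=2k\ge 2$ there is a constant $0<A_p\le 1$ depending only on $p$ such that the following holds. Let $(\Omega,m)$ be any measure space and let $(d_i)_{i\in I}$ be a finite family in $L_p(\Omega,m)$ which is $p$-orthogonal, i.e. for every injective map $g\colon\{1,\dots,p\}\to I$, $$\int \overline{d_{g(1)}}\,d_{g(2)}\,\overline{d_{g(3)}}\cdots\overline{d_{g(p-1)}}\,d_{g(p)}\,dm=0.$$ Let $S=\big(\sum_{i\in I}|d_i|^2\big)^{1/2}$. Then $$A_p\|S\|_p-\Big(\sum_{i\in I}\|d_i\|_p^p\Big)^{1/p}\le\Big\|\sum_{i\in I}d_i\Big\|_p\le 2p\,\|S\|_p .$$
   Context: $\|\cdot\|_p$ denotes the norm of $L_p(\Omega,m)$. *)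

(* Defs.v *)
From HB Require Import structures.
From mathcomp Require Import all_boot all_order all_algebra.
From mathcomp Require Import all_classical all_reals all_analysis.
From mathcomp Require Import complex Rstruct Rstruct_topology.
Set Implicit Arguments. Unset Strict Implicit. Unset Printing Implicit Defensive.
Import Order.TTheory GRing.Theory Num.Theory.
Local Open Scope ring_scope.
Local Open Scope complex_scope.

Notation RR := (Rdefinitions.R : realType).

Section Defs.
Context {R : realType}.
Local Notation CC := (R[i]).

Definition cmod (z : CC) : R := Num.sqrt (complex.Re z ^+ 2 + complex.Im z ^+ 2).

Definition cconj (z : CC) : CC := complex.conjc z.

Definition cmeasurable {d} {T : measurableType d} (f : T -> CC) : Prop :=
  measurable_fun [set: T] (fun x => complex.Re (f x)) /\
  measurable_fun [set: T] (fun x => complex.Im (f x)).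

Definition cLnorm {d} {T : measurableType d} (mu : {measure set T -> \bar R})
  (p : R) (f : T -> CC) : \bar R :=
  Lnorm mu p%:E (fun x => (cmod (f x))%:E).

Definition inLp {d} {T : measurableType d} (mu : {measure set T -> \bar R})
  (p : R) (f : T -> CC) : Prop :=
  cmeasurable f /\ (cLnorm mu p f < +oo)%E.

(* the product conj(d_{g 1}) d_{g 2} conj(d_{g 3}) ... d_{g p}:
   positions 1,3,5,... (i.e. 0-indexed j even) are conjugated *)
Definition alt_prod {T} {I : finType} (p : nat) (dd : I -> T -> CC)
  (g : 'I_p -> I) (x : T) : CC :=
  \prod_(j < p) (if ~~ odd j then cconj (dd (g j) x) else dd (g j) x).

Definition p_orthogonal {d} {T : measurableType d}
  (mu : {measure set T -> \bar R}) {I : finType} (p : nat) (dd : I -> T -> CC) : Prop :=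
  forall g : 'I_p -> I, injective g ->
    (\int[mu]_x (complex.Re (alt_prod dd g x))%:E = 0)%E /\
    (\int[mu]_x (complex.Im (alt_prod dd g x))%:E = 0)%E.

Definition sqfun {T} {I : finType} (dd : I -> T -> CC) (x : T) : CC :=
  (Num.sqrt (\sum_(i : I) cmod (dd i x) ^+ 2)) +i* 0.

End Defs.

(* Main.v *)
Require Import Defs.
From HB Require Import structures.
From mathcomp Require Import all_boot all_order all_algebra.
From mathcomp Require Import all_classical all_reals all_analysis.
From mathcomp Require Import complex Rstruct Rstruct_topology.
From mathcomp Require Import all_fingroup measurable_realfun ring lra zify.
Set Implicit Arguments. Unset Strict Implicit. Unset Printing Implicit Defensive.
Import Order.TTheory GRing.Theory Num.Theory.
Local Open Scope ring_scope.

(**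
Put [f = \sum_i d_i] and expand [|f|^p] as a sum over all maps [g : {1..p} -> I].
The signs of the permutations [s] with [g \o s = g] add up to 1 if [g] is injective
and to 0 otherwise, so the sum [P] over injective [g], which integrates to 0, equals
[\sum_s sgn(s) T_s], where [T_s] sums over the [s]-invariant maps and factors over
the cycles of [s]: a fixed point contributes [f] or its conjugate, a cycle of length
[l >= 2] at most [S^l].

Upper bound: [T_1 = |f|^p], and at most [p^n] permutations move exactly [n >= 2]
points. Since [|f|^(p-n) (2pS)^n <= |f|^p + (2pS)^p], pointwise
[| |f|^p - P | <= (|f|^p + (2pS)^p) / 2], and one integrates.

Lower bound: fixed-point-free involutions all have sign [(-1)^(p/2)] and [T_s >= 0],
and one of them has [T_s = S^p]. Any other [s] has a fixed point or a cycle of length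
at least 3, so that [|T_s| <= N max(N, S)^(p-1)] whenever [N >= |f|, |d_i|]; this is at
most [e S^p + e^(-p) (|f|^p + \sum_i |d_i|^p)]. Taking [e = 1/(2 p!)], half of [S^p]
survives.
*)

(** * Sums over injective maps and permutations *)

Section InvariantSums.
Variables (C : numClosedFieldType) (I J : finType).
Implicit Types (s : {perm J}) (h : J -> I -> C) (g : {ffun J -> I}).

Definition invariant_under s g := [forall j, g (s j) == g j].

(** This is [T_s] of the overview, for arbitrary factors [h j]. *)
Definition invariant_sum s h := \sum_(g | invariant_under s g) \prod_j h j (g j).

(** If [g i = g j] with [i != j], right multiplication by the transposition
    [(i j)] is a sign-reversing involution of the stabilizer of [g]. *)
Lemma sum_sign_stabilizer g :
  \sum_(s : {perm J} | invariant_under s g) (-1) ^+ s = (injectiveb g)%:R :> C.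
Proof.
case: injectiveP => [inj_g|/injectiveP/injectivePn[i [j ij gij]]].
  rewrite (big_pred1 (1 : {perm J})%g) ?odd_perm1// => s.
  apply/forallP/eqP => [gs|-> j]; last by rewrite perm1.
  by apply/permP => j; rewrite perm1; apply: inj_g; apply/eqP.
set S := LHS; suff: S = - S.
  by move/eqP; rewrite -addr_eq0 -mulr2n mulrn_eq0/= => /eqP.
rewrite {1}/S (reindex_inj (mulIg (tperm i j))) -sumrN; apply: eq_big => s.
  apply: eq_forallb => x; rewrite permM.
  by case: tpermP => [->|->|]//; rewrite gij.
by rewrite odd_permM odd_tperm ij signr_addb expr1 mulrN1.
Qed.

(** After exchanging the sums on the right, each [g] carries the total sign of its stabilizer, which
    [sum_sign_stabilizer] evaluates. *)
Lemma sum_injective h :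
  \sum_(g : {ffun J -> I} | injectiveb g) \prod_j h j (g j) =
  \sum_(s : {perm J}) (-1) ^+ s * invariant_sum s h.
Proof.
under [RHS]eq_bigr do rewrite mulr_sumr.
rewrite (exchange_big_dep xpredT)//= big_mkcond.
apply: eq_bigr => g _; rewrite -mulr_suml sum_sign_stabilizer.
by case: injectiveb; rewrite ?mul1r ?mul0r.
Qed.

Lemma prod_porbits s (E : J -> C) :
  \prod_j E j = \prod_(c in porbits s) \prod_(j in c) E j.
Proof.
rewrite [LHS](partition_big_imset (porbit s)).
apply: eq_bigr => _ /imsetP[x _ ->]; apply: eq_bigl => j.
by rewrite eq_porbit_mem.
Qed.

(** An invariant map is constant on orbits, hence amounts to a free choice of one value per orbit;
    distributing the product over the sums lists all these choices. *)
Lemma invariant_sumE s h :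
  invariant_sum s h = \prod_(c in porbits s) \sum_i \prod_(j in c) h j i.
Proof.
rewrite big_sub bigA_distr_bigA /=.
have cls_in j : porbit s j \in porbits s by apply: imset_f.
pose cls j : {c in porbits s} := Sub (porbit s j) (cls_in j).
have rep_ex (c : {c in porbits s}) : exists x, porbit s x == val c.
  by case/imsetP: (valP c) => x _ ->; exists x.
pose rep c := xchoose (rep_ex c).
have repK c : cls (rep c) = c by apply/val_inj/eqP/(xchooseP (rep_ex c)).
rewrite /invariant_sum.
(* Maps on orbits correspond to invariant maps: pull back along [cls] one way, evaluate at the
   representative [rep c] the other way. *)
rewrite (reindex_onto (fun G : {ffun {c in porbits s} -> I} => [ffun j => G (cls j)])
  (fun g => [ffun c => g (rep c)])) => [|g /forallP gs].
  apply: eq_big => [G|G _].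
    apply/andP; split.
      apply/forallP => j; rewrite !ffunE; apply/eqP; congr (G _).
      by apply: val_inj => /=; rewrite -[s j]/((s ^+ 1)%g j) porbit_perm.
    by apply/eqP/ffunP => c; rewrite !ffunE repK.
  rewrite (prod_porbits s) big_sub; apply: eq_bigr => c _.
  apply: eq_bigr => j jc; rewrite ffunE; congr (h _ (G _)).
  apply: val_inj => /=; rewrite -(repK c) /=.
  by move: jc; rewrite -{1}(repK c) /= -eq_porbit_mem => /eqP.
apply/ffunP => j; rewrite !ffunE.
(* The point [j] is the image of its representative under a power of [s], and [g] is unchanged along
   such powers. *)
have /porbitP[n jE] : j \in porbit s (rep (cls j)).
  by rewrite -eq_porbit_mem -[porbit s (rep _)]/(val (cls _)) repK.
rewrite [in RHS]jE; elim: n {jE} => [|n IHn]; first by rewrite perm1.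
by rewrite expgSr permM (eqP (gs _)).
Qed.

Lemma invariant_sum_eq s h (b : J -> C) :
  (forall x, \sum_i \prod_(j in porbit s x) h j i = \prod_(j in porbit s x) b j) ->
  invariant_sum s h = \prod_j b j.
Proof.
move=> hb; rewrite invariant_sumE (prod_porbits s).
by apply: eq_bigr => _ /imsetP[x _ ->].
Qed.

Lemma invariant_sum_le s h (b : J -> C) :
  (forall x, `|\sum_i \prod_(j in porbit s x) h j i| <= \prod_(j in porbit s x) b j) ->
  `|invariant_sum s h| <= \prod_j b j.
Proof.
move=> hb; rewrite invariant_sumE (prod_porbits s) normr_prod.
by apply: ler_prod => _ /imsetP[x _ ->]; rewrite normr_ge0 hb.
Qed.

(** A single cycle factor need not be real. The weights [u] rotate each factor to a nonnegative one,
    while their total product is itself nonnegative. *)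
Lemma invariant_sum_ge0 s h (u : J -> C) :
  (forall j, u j != 0) -> 0 <= \prod_j u j ->
  (forall x, 0 <= (\sum_i \prod_(j in porbit s x) h j i) / \prod_(j in porbit s x) u j) ->
  0 <= invariant_sum s h.
Proof.
move=> u0 pu hu.
have pu0 : \prod_j u j != 0 by apply/prodf_neq0 => j _.
rewrite -[invariant_sum _ _](divfK pu0) mulr_ge0//.
rewrite invariant_sumE (prod_porbits s) -prodf_div prodr_ge0//.
by move=> _ /imsetP[x _ ->].
Qed.

Lemma invariant_sum1 h : invariant_sum 1%g h = \prod_j \sum_i h j i.
Proof.
rewrite bigA_distr_bigA; apply: eq_bigl => g.
by apply/forallP => j; rewrite perm1.
Qed.

End InvariantSums.

(** * Short and long cycles of a permutation *)

Section Cycles.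
Variables (J : finType).
Implicit Types (s : {perm J}) (x : J).

Lemma porbit_fix s x : s x = x -> porbit s x = [set x].
Proof.
move=> sx; apply/setP => y; rewrite inE; apply/porbitP/eqP => [[n ->]|->].
  by elim: n => [|n IHn]; rewrite ?perm1// expgSr permM IHn.
by exists 0%N; rewrite perm1.
Qed.

Lemma porbit_swap s x : s (s x) = x -> porbit s x = [set x; s x].
Proof.
move=> sx; apply/setP => y; rewrite !inE.
apply/porbitP/idP => [[n ->]|/orP[]/eqP->].
- elim: n => [|n]; first by rewrite perm1 eqxx.
  by rewrite expgSr permM => /orP[]/eqP->; rewrite ?sx eqxx ?orbT.
- by exists 0%N; rewrite perm1.
- by exists 1%N; rewrite expg1.
Qed.

Lemma porbit_gt1 s x : s x != x -> (1 < #|porbit s x|)%N.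
Proof.
move=> sx; rewrite (cardsD1 x) porbit_id (cardsD1 (s x)) !inE sx.
by rewrite -[s x]/((s ^+ 1)%g x) mem_porbit.
Qed.

Lemma porbit_gt2 s x : s x != x -> s (s x) != x -> (2 < #|porbit s x|)%N.
Proof.
move=> sx ssx; rewrite (cardsD1 x) porbit_id (cardsD1 (s x)) !inE sx.
rewrite -{1}[s x]/((s ^+ 1)%g x) mem_porbit (cardsD1 (s (s x))) !inE ssx.
rewrite (inj_eq perm_inj) sx.
by have := mem_porbit s 2 x; rewrite expgS permM => ->.
Qed.

(** The fixed-point-free involutions, that is, the partitions of [J] into pairs. *)
Definition pairing s := [forall x, (s x != x) && (s (s x) == x)].

End Cycles.

(** * Counting permutations by the size of their support *)

Section Counting.
Variables (C : numClosedFieldType) (J : finType).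

Lemma card_support_perm n :
  (#|[set s : {perm J} | #|[set x | s x != x]| == n]| <= #|J| ^ n)%N.
Proof.
apply: (@leq_trans (#|J| ^_ n)%N); last first.
  by elim: n => // n IHn; rewrite ffactnSr expnSr leq_mul// leq_subr.
rewrite -bin_ffact -card_draws -sum_nat_const.
apply: leq_trans (_ : #|\bigcup_(A in [set A : {set J} | #|A| == n])
  [set s | perm_on A s]| <= _)%N.
  apply: subset_leq_card; apply/fintype.subsetP => s; rewrite inE => sn.
  apply/finset.bigcupP; exists [set x | s x != x]; rewrite !inE//.
  by apply/fintype.subsetP => x; rewrite !inE.
elim/big_rec2: _ => [|A m D /[!inE] /eqP An IH]; first by rewrite cards0.
rewrite (leq_trans (leq_card_setU _ _))// leq_add// -An -card_perm.
by rewrite cardsE.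
Qed.

(** If [x] is moved then so is [s x], by injectivity. *)
Lemma card_support_neq1 (s : {perm J}) : s != 1%g -> (1 < #|[set x | s x != x]|)%N.
Proof.
move=> s1; have [x sx] : exists x, s x != x.
  apply/existsP; apply: contraNT s1; rewrite negb_exists => /forallP s1.
  by apply/eqP/permP => x; rewrite perm1; apply/eqP; rewrite -[_ == _]negbK s1.
rewrite (cardsD1 x) inE sx (cardsD1 (s x)) !inE sx (inj_eq perm_inj).
by rewrite eq_sym eq_sym sx.
Qed.

(** Grouped by support size [n], the at most [#|J| ^ n] permutations weigh at most [2^-1 ^+ n]
    together; the geometric series from [n = 2] on has sum [2^-1]. *)
Lemma sum_support_weight : (0 < #|J|)%N ->
  \sum_(s : {perm J} | s != 1%g) ((2 * #|J|)%:R^-1) ^+ #|[set x | s x != x]| <= 2^-1 :> C.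
Proof.
move=> J0.
pose m (s : {perm J}) : 'I_(#|J|.+1) := inord #|[set x | s x != x]|.
have mE s : m s = #|[set x | s x != x]| :> nat by rewrite inordK// ltnS max_card.
rewrite (partition_big m (fun n => (1 < n)%N)) /= => [|s s1]; last first.
  by rewrite mE card_support_neq1.
apply: (@le_trans _ _ (\sum_(n < #|J|.+1 | (1 < n)%N) 2^-1 ^+ n)).
  apply: ler_sum => n n1.
  rewrite (eq_bigr (fun=> (2 * #|J|)%:R^-1 ^+ n)) => [|s /andP[_ /eqP <-]];
    last by rewrite mE.
  rewrite sumr_const -[leLHS]mulr_natl.
  apply: (@le_trans _ _ ((#|J| ^ n)%:R * (2 * #|J|)%:R^-1 ^+ n)).
    rewrite ler_wpM2r ?exprn_ge0 ?invr_ge0 ?ler0n// ler_nat.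
    apply: leq_trans (card_support_perm n); apply: subset_leq_card.
    by apply/fintype.subsetP => s; rewrite !inE -mE => /andP[_ /eqP->].
  by rewrite natrX -exprMn natrM invfM mulrCA mulfV ?mulr1// pnatr_eq0 -lt0n.
have geo n : \sum_(i < n.+2 | (1 < i)%N) 2^-1 ^+ i = 2^-1 - 2^-1 ^+ n.+1 :> C.
  elim: n => [|n IHn].
    by rewrite big_mkcond !big_ord_recl big_ord0 /= !addr0 expr1 subrr.
  rewrite big_mkcond big_ord_recr -big_mkcond /= IHn -addrA; congr (_ + _).
  by rewrite !(exprSr _ n.+1); field.
by case: #|J| J0 => // n _; rewrite geo gerBl exprn_ge0// invr_ge0 ler0n.
Qed.

End Counting.

(** * Estimates for the alternating sum at a single point *)

Section AlternatingSums.
Variables (C : numClosedFieldType) (I : finType) (k : nat) (d : I -> C).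

(** Same conjugation pattern as in [alt_prod], with positions counted from 0. *)
Definition alternate (z : C) (j : 'I_(2 * k)) := if ~~ odd j then z^* else z.

Let h j i := alternate (d i) j.
Let f := \sum_i d i.
Let X : C := `|f|.
Let S := sqrtC (\sum_i `|d i| ^+ 2).

(** This is [P] of the overview, at one point of the measure space. *)
Definition injective_sum :=
  \sum_(g : {ffun 'I_(2 * k) -> I} | injectiveb g) \prod_j alternate (d (g j)) j.

Lemma norm_alternate z j : `|alternate z j| = `|z|.
Proof. by rewrite /alternate; case: ifP; rewrite ?norm_conjC. Qed.

Lemma sum_alternate j : \sum_i alternate (d i) j = alternate f j.
Proof. by rewrite /alternate; case: ifP => _ //; rewrite rmorph_sum. Qed.

Lemma prod_alternate z : \prod_j alternate z j = `|z| ^+ (2 * k).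
Proof.
rewrite /alternate; elim: k => [|n IHn]; first by rewrite muln0 big_ord0.
rewrite mulnS !big_ord_recl /= exprD normCK -IHn mulrA; congr (_ * _).
  exact: mulrC.
by apply: eq_bigr => j _; rewrite /bump /= negbK.
Qed.

Let sumsq_ge0 : 0 <= \sum_i `|d i| ^+ 2.
Proof. by apply: sumr_ge0 => i _; rewrite exprn_ge0. Qed.

Let S_ge0 : 0 <= S. Proof. by rewrite sqrtC_ge0. Qed.

Let S_sqr : S ^+ 2 = \sum_i `|d i| ^+ 2. Proof. exact: sqrtCK. Qed.

Let le_S i : `|d i| <= S.
Proof.
rewrite -(@ler_pXn2r _ 2) ?nnegrE// S_sqr (bigD1 i)//= lerDl.
by apply: sumr_ge0 => j _; rewrite exprn_ge0.
Qed.

(** Two of the factors sum to [S ^+ 2]; the other [n] are each at most [S]. This bounds any cycle of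
    length at least 2. *)
Let sum_pow_le n : \sum_i `|d i| ^+ n.+2 <= S ^+ n.+2.
Proof.
rewrite -addn2 exprD S_sqr mulr_sumr; apply: ler_sum => i _.
by rewrite exprD ler_wpM2r ?exprn_ge0// lerXn2r ?nnegrE.
Qed.

(** A cycle of length at least 3 can spare one factor for the bound [N], two others still being
    available to form [S ^+ 2]. *)
Let sum_pow3_le (N : C) n : 0 <= N -> (forall i, `|d i| <= N) ->
  \sum_i `|d i| ^+ n.+3 <= N * S ^+ n.+2.
Proof.
move=> N0 dN; apply: (@le_trans _ _ (N * \sum_i `|d i| ^+ n.+2)).
  by rewrite mulr_sumr; apply: ler_sum => i _; rewrite exprS ler_wpM2r ?exprn_ge0.
exact: ler_wpM2l.
Qed.

Let cycle_le (A : {set 'I_(2 * k)}) :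
  `|\sum_i \prod_(j in A) h j i| <= \sum_i `|d i| ^+ #|A|.
Proof.
apply: le_trans (ler_norm_sum _ _ _) _; apply: ler_sum => i _.
rewrite normr_prod (eq_bigr (fun=> `|d i|)) ?prodr_const// => j _.
by rewrite norm_alternate.
Qed.

Let cycle1_norm x : `|\sum_i \prod_(j in [set x]) h j i| = X.
Proof.
under eq_bigr do rewrite big_set1.
by rewrite sum_alternate norm_alternate.
Qed.

Let sum_perm : injective_sum = \sum_(s : {perm 'I_(2 * k)}) (-1) ^+ s * invariant_sum s h.
Proof. exact: (sum_injective h). Qed.

Lemma norm_injective_sum_sub_le : (0 < k)%N ->
  `|X ^+ (2 * k) - injective_sum| <=
    2^-1 * (X ^+ (2 * k) + ((2 * (2 * k))%:R * S) ^+ (2 * k)).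
Proof.
move=> k0; set Y := _%:R * S; set M := X ^+ _ + Y ^+ _.
have p0 : (2 * (2 * k))%:R != 0 :> C by rewrite pnatr_eq0; lia.
have Y0 : 0 <= Y by rewrite mulr_ge0.
have X0 : 0 <= X by exact: normr_ge0.
rewrite sum_perm (bigD1 1%g)//= odd_perm1 mul1r invariant_sum1.
under eq_bigr do rewrite sum_alternate.
rewrite prod_alternate -/X opprD addNKr normrN.
apply: le_trans (ler_norm_sum _ _ _) _.
apply: (@le_trans _ _ (\sum_(s : {perm 'I_(2 * k)} | s != 1%g)
   (2 * #|'I_(2 * k)|)%:R^-1 ^+ #|[set x | s x != x]| * M)); last first.
  rewrite -mulr_suml ler_wpM2r ?addr_ge0 ?exprn_ge0//.
  by apply: sum_support_weight; rewrite card_ord; lia.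
apply: ler_sum => s _; rewrite normrM normr_sign mul1r card_ord.
(* The product [w j * c j] is [X] at a fixed point and [S] at a moved one, since [w j] cancels the
   factor built into [Y]. *)
pose w j : C := if s j == j then 1 else (2 * (2 * k))%:R^-1.
pose c j := if s j == j then X else Y.
apply: (@le_trans _ _ (\prod_j (w j * c j))).
  apply: invariant_sum_le => x; rewrite /w /c; have [sx|sx] := eqVneq (s x) x.
    by rewrite porbit_fix// cycle1_norm big_set1 sx eqxx mul1r.
  apply: le_trans (cycle_le _) _; rewrite [leRHS](eq_bigr (fun=> S)) => [|j jx].
    rewrite prodr_const; have := porbit_gt1 sx.
    by case: #|_| => [|[|n]]// _; exact: sum_pow_le.
  (* The orbit of a moved point contains no fixed point [j], whose own orbit is [[set j]]. *)
  rewrite ifN ?ifN ?mulKf//; apply: contraNneq sx => sj;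
  by have := jx; rewrite porbit_sym porbit_fix// inE => /eqP->; rewrite sj.
rewrite big_split /= ler_pM ?prodr_ge0//.
- by move=> j _; rewrite /w; case: ifP => // _; rewrite invr_ge0.
- by move=> j _; rewrite /c; case: ifP.
- rewrite -prodr_const [leRHS]big_mkcond le_eqVlt; apply/orP; left; apply/eqP.
  by apply: eq_bigr => j _; rewrite inE /w; case: eqP.
(* Every [c j] is at most the larger of [X] and [Y], whose power is one of the two terms of [M]. *)
have [XY|YX] : X <= Y \/ Y <= X by apply/orP/real_leVge; apply: ger0_real.
  apply: (@le_trans _ _ (Y ^+ (2 * k))); last by rewrite lerDr exprn_ge0.
  rewrite -[in leRHS](card_ord (2 * k)) -prodr_const.
  by apply: ler_prod => j _; rewrite /c; case: ifP; rewrite ?X0 ?Y0 ?lexx.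
apply: (@le_trans _ _ (X ^+ (2 * k))); last by rewrite lerDl exprn_ge0.
rewrite -[in leRHS](card_ord (2 * k)) -prodr_const.
by apply: ler_prod => j _; rewrite /c; case: ifP; rewrite ?X0 ?Y0 ?lexx.
Qed.

(** Some point [x0] is fixed or lies on a cycle of length at least 3. Its cycle supplies the one
    factor [N]; all other points are bounded by [Q]. *)
Let nonpairing_le_mul (s : {perm 'I_(2 * k)}) (N Q : C) : ~~ pairing s ->
  N <= Q -> X <= N -> (forall i, `|d i| <= N) -> S <= Q ->
  `|invariant_sum s h| <= N * Q ^+ (2 * k).-1.
Proof.
rewrite negb_forall => /existsP[x0]; rewrite negb_and negbK => sx0 NQ XN dN SQ.
have N0 : 0 <= N by exact: le_trans (normr_ge0 _) XN.
have Q0 : 0 <= Q by exact: le_trans NQ.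
pose b j := if j == x0 then N else Q.
have bE (A : {set 'I_(2 * k)}) : x0 \in A -> \prod_(j in A) b j = N * Q ^+ #|A|.-1.
  move=> x0A; rewrite (bigD1 x0)//= /b eqxx; congr (_ * _).
  rewrite (eq_bigr (fun=> Q)) => [|j /andP[_ /negPf->]]//.
  rewrite prodr_const (cardsD1 x0) x0A; congr (_ ^+ _) => /=.
  by apply: eq_card => j; rewrite !inE andbC.
have -> : N * Q ^+ (2 * k).-1 = \prod_j b j.
  rewrite -[in LHS](card_ord (2 * k)) -cardsT -bE ?inE//.
  by apply: eq_bigl => j; rewrite inE.
apply: invariant_sum_le => x.
have [x0x|x0x] := boolP (x0 \in porbit s x).
  rewrite bE//; have /eqP <- : porbit s x0 == porbit s x by rewrite eq_porbit_mem.
  case: (eqVneq (s x0) x0) sx0 => [sx0 _|sx0 ssx0].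
    by rewrite porbit_fix// cycle1_norm cards1 mulr1.
  apply: le_trans (cycle_le _) _; have := porbit_gt2 sx0 ssx0.
  case: #|_| => [|[|[|n]]]// _; apply: le_trans (sum_pow3_le _ N0 dN) _.
  by rewrite ler_wpM2l// lerXn2r ?nnegrE.
rewrite [leRHS](eq_bigr (fun=> Q)) => [|j jx]; last first.
  by rewrite /b ifN//; apply: contraNneq x0x => <-.
rewrite prodr_const; have [sx|sx] := eqVneq (s x) x.
  by rewrite porbit_fix// cycle1_norm cards1 expr1 (le_trans XN).
apply: le_trans (cycle_le _) _; have := porbit_gt1 sx.
case: #|_| => [|[|n]]// _; apply: le_trans (sum_pow_le _) _.
by rewrite lerXn2r ?nnegrE.
Qed.

Let D := X ^+ (2 * k) + \sum_i `|d i| ^+ (2 * k).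

(** Let [Y] be the root of [D] of order [2 * k], which dominates [X] and all [|d i|]. If
    [Y <= e * S], take [N = e * S] and [Q = S], which gives the first term; otherwise
    [N = Q = e^-1 * Y] gives the second. *)
Let nonpairing_le (s : {perm 'I_(2 * k)}) (e : C) : (0 < k)%N -> ~~ pairing s ->
  0 < e -> e <= 1 ->
  `|invariant_sum s h| <= e * S ^+ (2 * k) + e^-1 ^+ (2 * k) * D.
Proof.
move=> k0 np e0 e1.
have p0 : (0 < 2 * k)%N by lia.
have pE : (2 * k).-1.+1 = (2 * k)%N by rewrite prednK.
have sum0 : 0 <= \sum_i `|d i| ^+ (2 * k) by apply: sumr_ge0 => i _; rewrite exprn_ge0.
have X0 : 0 <= X by exact: normr_ge0.
have D0 : 0 <= D by rewrite addr_ge0 ?exprn_ge0.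
pose Y := (2 * k).-root D.
have Y0 : 0 <= Y by rewrite rootC_ge0.
have YE : Y ^+ (2 * k) = D by apply: rootCK.
have XY : X <= Y by rewrite -(ler_pXn2r p0) ?nnegrE// YE lerDl.
have dY i : `|d i| <= Y.
  rewrite -(ler_pXn2r p0) ?nnegrE// YE ler_wpDl ?exprn_ge0//.
  by rewrite (bigD1 i)//= lerDl; apply: sumr_ge0 => j _; rewrite exprn_ge0.
have eV : 0 <= e^-1 by rewrite invr_ge0 ltW.
have [YS|SY] : Y <= e * S \/ e * S <= Y.
- by apply/orP/real_leVge; rewrite ger0_real// mulr_ge0// ltW.
- have := @nonpairing_le_mul s (e * S) S np; rewrite -mulrA -exprS pE.
  move=> H; apply: le_trans (H _ _ _ _) _ => //.
  + by rewrite ler_piMl.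
  + exact: le_trans XY YS.
  + by move=> i; exact: le_trans (dY i) YS.
  + by rewrite lerDl mulr_ge0 ?exprn_ge0.
have := @nonpairing_le_mul s (e^-1 * Y) (e^-1 * Y) np.
have YeY : Y <= e^-1 * Y by rewrite ler_peMl// invf_ge1.
rewrite -exprS pE exprMn YE => H; apply: le_trans (H _ _ _ _) _ => //.
- exact: le_trans XY YeY.
- by move=> i; exact: le_trans (dY i) YeY.
- by rewrite ler_pdivlMl.
- by rewrite lerDr mulr_ge0 ?exprn_ge0// ltW.
Qed.

Let cycle2E (s : {perm 'I_(2 * k)}) x (E : 'I_(2 * k) -> C) : pairing s ->
  \prod_(j in porbit s x) E j = E x * E (s x).
Proof.
move=> /forallP/(_ x)/andP[sx /eqP ssx].
by rewrite porbit_swap// big_setU1 ?big_set1//= inE eq_sym.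
Qed.

(** With [v] a square root of [\sum_i d i ^+ 2], dividing each [d i] by [v] and each
    conjugate by the conjugate of [v] makes the contribution of every 2-cycle
    nonnegative, and divides the product by [`|v| ^+ (2 * k)]. *)
Let pairing_ge0 (s : {perm 'I_(2 * k)}) : pairing s -> 0 <= invariant_sum s h.
Proof.
move=> ps; pose w := \sum_i d i ^+ 2.
(* When [w] vanishes any nonzero [v] serves, because [w / v ^+ 2] is then 0. *)
pose v := if w == 0 then 1 else sqrtC w.
have v0 : v != 0.
  by rewrite /v; case: ifPn; rewrite ?oner_neq0// => w0; rewrite sqrtC_eq0.
have wv : 0 <= w / v ^+ 2.
  rewrite /v; case: eqP => [->|/eqP w0]; first by rewrite mul0r.
  by rewrite sqrtCK divff.
apply: (@invariant_sum_ge0 _ _ _ _ _ (alternate v)) => [j||x].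
- by rewrite -normr_eq0 norm_alternate normr_eq0.
- by rewrite prod_alternate exprn_ge0.
rewrite cycle2E//; under eq_bigr do rewrite cycle2E//.
(* Cases on the parities of [x] and [s x]: equal parities give [w] or its conjugate, opposite
   parities give the sum of the [|d i| ^+ 2]. *)
rewrite /h /alternate; case: ifP => _; case: ifP => _.
- under eq_bigr do rewrite -rmorphM.
  by rewrite -rmorph_sum -rmorphM -fmorphV -rmorphM conjC_ge0.
- under eq_bigr do rewrite mulrC -normCK.
  by rewrite [v^* * v]mulrC -normCK; apply: divr_ge0; rewrite ?exprn_ge0.
- under eq_bigr do rewrite -normCK.
  by rewrite -normCK; apply: divr_ge0; rewrite ?exprn_ge0.
- by rewrite -expr2; under eq_bigr do rewrite -expr2.
Qed.

(** [(-1) ^+ #|porbits s|] is computed as the product of ['i] over the points. *)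
Let sign_pairing (s : {perm 'I_(2 * k)}) : pairing s -> (-1) ^+ s = (-1) ^+ k :> C.
Proof.
move=> ps; rewrite /odd_perm card_ord oddM /= signr_odd.
have := prod_porbits s (fun=> 'i : C).
rewrite prodr_const card_ord exprM sqrCi => ->.
rewrite -prodr_const; apply: eq_bigr => _ /imsetP[x _ ->].
by rewrite cycle2E// -expr2 sqrCi.
Qed.

(** The witness swaps each even position with the next odd one, so every cycle joins a conjugated
    factor to a plain one and contributes [S ^+ 2]. *)
Let exists_pairing : exists2 s : {perm 'I_(2 * k)},
  pairing s & invariant_sum s h = S ^+ (2 * k).
Proof.
have lt_t (j : 'I_(2 * k)) : ((if odd j then j.-1 else j.+1) < 2 * k)%N.
  by case: j => j /= jk; case: ifP => oj; lia.
pose t j := Ordinal (lt_t j).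
have tK : involutive t.
  move=> j; apply: val_inj => /=; case: j => [[|j] jk] //=.
  by case oj: (odd j) => /=; rewrite oj.
pose s := perm (inv_inj tK).
have odd_s j : odd (s j) = ~~ odd j.
  rewrite permE /=; case: j => [[|j] jk] //=.
  by case oj: (odd j) => /=; rewrite oj.
have ps : pairing s.
  apply/forallP => j; apply/andP; split; last by rewrite !permE tK.
  by apply/eqP => sj; have := odd_s j; rewrite sj; case: odd.
exists s => //; rewrite -[in RHS](card_ord (2 * k)) -prodr_const.
apply: invariant_sum_eq => x; rewrite cycle2E// -expr2 S_sqr.
apply: eq_bigr => i _; rewrite cycle2E// /h /alternate odd_s normCK.
by case: odd; rewrite //= mulrC.
Qed.

(** Here [G] sums over the pairings, whose common sign [(-1) ^+ k] is cancelled by the prefactor;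
    the error comes from the other permutations. *)
Lemma injective_sum_approx : (0 < k)%N ->
  exists2 G, S ^+ (2 * k) <= G &
  `|G - (-1) ^+ k * injective_sum| <= 2^-1 * S ^+ (2 * k) +
     (2 * k)`!%:R * (2 * (2 * k)`!)%:R ^+ (2 * k) * D.
Proof.
move=> k0; pose e : C := (2 * (2 * k)`!)%:R^-1.
have f0 : (0 < (2 * k)`!)%N := fact_gt0 _.
have e0 : 0 < e by rewrite invr_gt0 ltr0n; lia.
have e1 : e <= 1 by rewrite invf_le1 ?ler1n ?ltr0n; lia.
exists (\sum_(s : {perm 'I_(2 * k)} | pairing s) invariant_sum s h).
  have [s ps <-] := exists_pairing; rewrite (bigD1 s)//= lerDl.
  by apply: sumr_ge0 => r /andP[pr _]; exact: pairing_ge0.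
rewrite sum_perm [X in _ * X](bigID (@pairing _)) /= mulrDr opprD addrA mulr_sumr.
rewrite [X in _ - X + _](eq_bigr (fun s => invariant_sum s h)) => [|s ps]; last first.
  by rewrite sign_pairing// mulrA -exprMn mulrNN mulr1 expr1n mul1r.
rewrite subrr sub0r normrN normrM normr_sign mul1r.
apply: le_trans (ler_norm_sum _ _ _) _.
apply: (@le_trans _ _ (\sum_(s : {perm 'I_(2 * k)} | ~~ pairing s)
   (e * S ^+ (2 * k) + e^-1 ^+ (2 * k) * D))).
  by apply: ler_sum => s np; rewrite normrM normr_sign mul1r nonpairing_le.
set B := _ + _; have B0 : 0 <= B.
  apply: addr_ge0; first by rewrite mulr_ge0 ?exprn_ge0// ltW.
  rewrite mulr_ge0 ?exprn_ge0 ?invr_ge0 ?(ltW e0)//.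
  by rewrite addr_ge0 ?exprn_ge0 ?normr_ge0// sumr_ge0// => i _; rewrite exprn_ge0.
apply: (@le_trans _ _ ((2 * k)`!%:R * B)).
  rewrite sumr_const -[leLHS]mulr_natl ler_wpM2r// ler_nat.
  by rewrite -card_Sn; apply: max_card.
have F0 : (2 * k)`!%:R != 0 :> C by rewrite pnatr_eq0; lia.
have e2 : (2 * k)`!%:R * e = 2^-1 by rewrite /e natrM invfM mulrCA mulfV ?mulr1.
by rewrite /B mulrDr !mulrA e2 /e invrK.
Qed.

End AlternatingSums.

(** * Integration *)

Section PointwiseEstimates.
Variables (R : realType) (I : finType) (k : nat) (d : I -> R[i]).
Hypothesis k_gt0 : (0 < k)%N.

Let F := cmod (\sum_i d i).
Let S := Num.sqrt (\sum_i cmod (d i) ^+ 2).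
Let P := complex.Re (injective_sum k d).

Lemma cmodE (z : R[i]) : `|z| = (cmod z)%:C%C.
Proof. by rewrite normc_def. Qed.

Lemma cconjE (z : R[i]) : cconj z = z^*.
Proof. by []. Qed.

Lemma cmod_ge0 (z : R[i]) : 0 <= cmod z.
Proof. exact: sqrtr_ge0. Qed.

Lemma Re_le_cmod (z : R[i]) : `|complex.Re z| <= cmod z.
Proof. by rewrite -lecR -cmodE normc_ge_Re. Qed.

Let rD := rmorphD (real_complex R).
Let rM := rmorphM (real_complex R).
Let rX := rmorphXn (real_complex R).

Let sqrtC_sumsq : sqrtC (\sum_i `|d i| ^+ 2) = S%:C%C.
Proof.
have -> : \sum_i `|d i| ^+ 2 = (S%:C%C) ^+ 2.
  rewrite -rmorphXn /= sqr_sqrtr ?sumr_ge0//; last by move=> i _; exact: sqr_ge0.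
  by rewrite rmorph_sum; apply: eq_bigr => i _; rewrite /= cmodE rmorphXn.
by rewrite sqrCK// ler0c sqrtr_ge0.
Qed.

Lemma cmod_sum_pow_le :
  F ^+ (2 * k) - P <= 2^-1 * (F ^+ (2 * k) + ((2 * (2 * k))%:R * S) ^+ (2 * k)).
Proof.
have := norm_injective_sum_sub_le d k_gt0.
rewrite sqrtC_sumsq [`|\sum_i d i|]cmodE -/F.
have -> : 2^-1 * (F%:C%C ^+ (2 * k) + ((2 * (2 * k))%:R * S%:C%C) ^+ (2 * k)) =
    (2^-1 * (F ^+ (2 * k) + ((2 * (2 * k))%:R * S) ^+ (2 * k)))%:C%C.
  by rewrite rM fmorphV rmorph_nat rD !rX rM rmorph_nat.
rewrite cmodE lecR; apply: le_trans; apply: le_trans (Re_le_cmod _).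
by apply: le_trans (ler_norm _); rewrite raddfB /= -rmorphXn.
Qed.

Lemma square_fun_pow_le :
  2^-1 * S ^+ (2 * k) - (-1) ^+ k * P <=
  (2 * k)`!%:R * (2 * (2 * k)`!)%:R ^+ (2 * k) *
    (F ^+ (2 * k) + \sum_i cmod (d i) ^+ (2 * k)).
Proof.
have [G] := injective_sum_approx d k_gt0.
rewrite sqrtC_sumsq [`|\sum_i d i|]cmodE -/F.
under eq_bigr do rewrite cmodE.
set B := (2 * k)`!%:R * _.
have -> : 2^-1 * S%:C%C ^+ (2 * k) +
    B * (F%:C%C ^+ (2 * k) + \sum_i (cmod (d i))%:C%C ^+ (2 * k)) =
    (2^-1 * S ^+ (2 * k) + (2 * k)`!%:R * (2 * (2 * k)`!)%:R ^+ (2 * k) *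
    (F ^+ (2 * k) + \sum_i cmod (d i) ^+ (2 * k)))%:C%C.
  rewrite !(rD, rM, rX) fmorphV !rmorph_nat rmorph_sum.
  by under [in RHS]eq_bigr do rewrite rmorphXn.
(* An inequality in [R[i]] equates imaginary parts and compares real parts; the comparison is
   kept. *)
rewrite -rmorphXn lecE /= => /andP[_ SG].
rewrite cmodE lecR => /(le_trans (Re_le_cmod _))/(le_trans (ler_norm _)).
have -> : (-1) ^+ k = ((-1) ^+ k)%:C%C :> R[i] by rewrite rmorphXn rmorphN1.
have -> z : complex.Re (G - ((-1) ^+ k)%:C%C * z) =
    complex.Re G - (-1) ^+ k * complex.Re z.
  by case: z => a b; rewrite raddfB /= mul0r subr0.
rewrite -/P.
lra.
Qed.

End PointwiseEstimates.

(** * Domination by power sums, through the largest term *)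

Section FiniteSums.
Variables (R : realType) (I : finType) (a : I -> R).
Hypothesis a_ge0 : forall i, 0 <= a i.

Lemma prod_le_sum_pow n (g : 'I_n -> I) : (0 < n)%N ->
  \prod_j a (g j) <= \sum_i a i ^+ n.
Proof.
case: n g => // n g _.
have [j _ aj] := @Order.TotalTheory.arg_maxP _ _ _ ord0 xpredT (fun j => a (g j)) isT.
apply: (@le_trans _ _ (a (g j) ^+ n.+1)).
  rewrite -[in leRHS](card_ord n.+1) -prodr_const.
  by apply: ler_prod => i _; rewrite a_ge0 /=; exact: aj.
by rewrite (bigD1 (g j))//= lerDl sumr_ge0// => i _; rewrite exprn_ge0.
Qed.

Lemma sum_pow_le_card n : (0 < n)%N ->
  (\sum_i a i) ^+ n <= #|I|%:R ^+ n * \sum_i a i ^+ n.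
Proof.
(* For empty [I] there is no largest term; both sides are then 0, as [n] is positive. *)
move=> n0; have [i0 _|I0] := pickP I; last first.
  by rewrite !big_pred0// mulr0 expr0n gtn_eqF.
have [i _ ai] := @Order.TotalTheory.arg_maxP _ _ _ i0 xpredT a isT.
apply: (@le_trans _ _ ((#|I|%:R * a i) ^+ n)).
  rewrite lerXn2r ?nnegrE ?sumr_ge0 ?mulr_ge0//.
  by rewrite mulr_natl -sumr_const; apply: ler_sum => j _; exact: ai.
rewrite exprMn ler_wpM2l ?exprn_ge0// (bigD1 i)//= lerDl.
by rewrite sumr_ge0// => j _; rewrite exprn_ge0.
Qed.

End FiniteSums.

(** * Measurability of complex functions *)

Section ComplexMeasurable.
Context {R : realType} d {T : measurableType d}.
Implicit Types f g : T -> R[i].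

Lemma cmeasurable_cst (c : R[i]) : cmeasurable (fun _ : T => c).
Proof. by split; exact: measurable_cst. Qed.

Lemma cmeasurableD f g : cmeasurable f -> cmeasurable g ->
  cmeasurable (fun x => f x + g x).
Proof.
move=> [rf jf] [rg jg]; split.
- by under eq_fun do rewrite raddfD; exact: measurable_funD.
- by under eq_fun do rewrite raddfD; exact: measurable_funD.
Qed.

Lemma cmeasurableM f g : cmeasurable f -> cmeasurable g ->
  cmeasurable (fun x => f x * g x).
Proof.
move=> [rf jf] [rg jg]; split.
- rewrite (_ : (fun _ => _) = (fun x => complex.Re (f x) * complex.Re (g x) -
    complex.Im (f x) * complex.Im (g x))).
    by apply: measurable_funB; exact: measurable_funM.
  by apply/funext => x; case: (f x) (g x) => [? ?] [? ?].
- rewrite (_ : (fun _ => _) = (fun x => complex.Re (f x) * complex.Im (g x) +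
    complex.Im (f x) * complex.Re (g x))).
    by apply: measurable_funD; exact: measurable_funM.
  by apply/funext => x; case: (f x) (g x) => [? ?] [? ?].
Qed.

Lemma cmeasurable_conj f : cmeasurable f -> cmeasurable (fun x => cconj (f x)).
Proof.
move=> [rf jf]; split.
- rewrite (_ : (fun _ => _) = (fun x => complex.Re (f x)))//.
  by apply/funext => x; case: (f x).
- rewrite (_ : (fun _ => _) = (fun x => - complex.Im (f x))).
    exact: measurableT_comp.
  by apply/funext => x; case: (f x).
Qed.

Lemma cmeasurable_sum (I : Type) (s : seq I) (h : I -> T -> R[i]) :
  (forall i, cmeasurable (h i)) -> cmeasurable (fun x => \sum_(i <- s) h i x).
Proof.
move=> mh; elim: s => [|i s IHs].
  by under eq_fun do rewrite big_nil; exact: cmeasurable_cst.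
by under eq_fun do rewrite big_cons; exact: cmeasurableD.
Qed.

Lemma cmeasurable_prod (I : Type) (s : seq I) (h : I -> T -> R[i]) :
  (forall i, cmeasurable (h i)) -> cmeasurable (fun x => \prod_(i <- s) h i x).
Proof.
move=> mh; elim: s => [|i s IHs].
  by under eq_fun do rewrite big_nil; exact: cmeasurable_cst.
by under eq_fun do rewrite big_cons; exact: cmeasurableM.
Qed.

Lemma measurable_cmod_sqr f : cmeasurable f ->
  measurable_fun [set: T] (fun x => cmod (f x) ^+ 2).
Proof.
move=> [rf jf]; under eq_fun do rewrite sqr_sqrtr ?addr_ge0 ?sqr_ge0//.
by apply: measurable_funD; exact: measurable_funX.
Qed.

(** An even exponent makes this a polynomial in the real and imaginary parts. *)
Lemma measurable_cmod_pow k f : cmeasurable f ->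
  measurable_fun [set: T] (fun x => cmod (f x) ^+ (2 * k)).
Proof.
move=> mf; under eq_fun do rewrite exprM.
exact/measurable_funX/measurable_cmod_sqr.
Qed.

Lemma cLnormE (mu : {measure set T -> \bar R}) n f :
  cLnorm mu n%:R f = ((\int[mu]_x (cmod (f x) ^+ n)%:E) `^ n%:R^-1)%E.
Proof.
rewrite /cLnorm unlock; congr (_ `^ _)%E; apply: eq_integral => x _ /=.
by rewrite ger0_norm ?powR_mulrn ?cmod_ge0.
Qed.

End ComplexMeasurable.

(** * Integrability of real functions *)

Section RealIntegrable.
Context {R : realType} d {T : measurableType d} (mu : {measure set T -> \bar R}).
Implicit Types f g : T -> R.

Lemma integrable_le f g : measurable_fun [set: T] f ->
  (forall x, `|f x| <= g x) -> mu.-integrable [set: T] (EFin \o g) ->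
  mu.-integrable [set: T] (EFin \o f).
Proof.
move=> mf fg; apply: le_integrable => //; first exact/measurable_EFinP.
by move=> x _; rewrite /= lee_fin (le_trans (fg x))// ler_norm.
Qed.

Lemma integrable_scale c f : mu.-integrable [set: T] (EFin \o f) ->
  mu.-integrable [set: T] (EFin \o (fun x => c * f x)).
Proof. by move=> fi; apply: (integrableZl measurableT c fi). Qed.

Lemma integrable_sum_fin (I : finType) (P : pred I) (h : I -> T -> R) :
  (forall i, mu.-integrable [set: T] (EFin \o h i)) ->
  mu.-integrable [set: T] (EFin \o (fun x => \sum_(i | P i) h i x)).
Proof.
move=> hi; rewrite (_ : _ \o _ = (fun x => \sum_(i | P i) (EFin \o h i) x)%E).
  exact: integrable_sum.
by apply/funext => x; rewrite /= sumEFin.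
Qed.

Lemma Rintegral_sum_fin (I : finType) (P : pred I) (h : I -> T -> R) :
  (forall i, mu.-integrable [set: T] (EFin \o h i)) ->
  (\int[mu]_x (\sum_(i | P i) h i x) = \sum_(i | P i) \int[mu]_x h i x)%R.
Proof.
move=> hi; rewrite /Rintegral.
under eq_integral do rewrite -sumEFin.
rewrite (integral_sum measurableT hi).
by rewrite -sum_fine// => i _; apply: integrable_fin_num.
Qed.

Lemma EFin_Rintegral f : mu.-integrable [set: T] (EFin \o f) ->
  (\int[mu]_x f x)%:E = (\int[mu]_x (f x)%:E)%E.
Proof. by move=> fi; rewrite fineK//; apply: integrable_fin_num. Qed.

End RealIntegrable.

(** * Integrated estimates for a p-orthogonal family *)

Section POrthogonal.
Context {R : realType} {d : measure_display} {T : measurableType d}.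
Variables (mu : {measure set T -> \bar R}) (I : finType) (k : nat) (dd : I -> T -> R[i]).
Hypotheses (k_gt0 : (0 < k)%N) (dd_Lp : forall i, inLp mu (2 * k)%:R (dd i)).

Let F x := cmod (\sum_i dd i x) ^+ (2 * k).
Let S x := Num.sqrt (\sum_i cmod (dd i x) ^+ 2) ^+ (2 * k).
Let D x := \sum_i cmod (dd i x) ^+ (2 * k).
Let P x := complex.Re (injective_sum k (dd^~ x)).

Let p_gt0 : (0 < 2 * k)%N. Proof. by rewrite muln_gt0. Qed.

Let dd_measurable i : cmeasurable (dd i). Proof. by case: (dd_Lp i). Qed.

Lemma integrable_cmod_pow i :
  mu.-integrable [set: T] (EFin \o (fun x => cmod (dd i x) ^+ (2 * k))).
Proof.
have [mi li] := dd_Lp i; apply/integrableP; split.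
  exact/measurable_EFinP/measurable_cmod_pow.
move: li; rewrite cLnormE => /lty_poweRy; rewrite invr_eq0 pnatr_eq0 -lt0n.
move=> /(_ p_gt0).
under eq_integral do rewrite /= -[X in X%:E]ger0_norm ?exprn_ge0 ?cmod_ge0//.
by under eq_integral do rewrite -abse_EFin.
Qed.

Let D_integrable : mu.-integrable [set: T] (EFin \o D).
Proof. by apply: integrable_sum_fin => i; exact: integrable_cmod_pow. Qed.

Let sum_cmod_pow_le x :
  (\sum_i cmod (dd i x)) ^+ (2 * k) <= #|I|%:R ^+ (2 * k) * D x.
Proof. by apply: sum_pow_le_card => // i; exact: cmod_ge0. Qed.

Lemma cmod_sum (a : I -> R[i]) : cmod (\sum_i a i) <= \sum_i cmod (a i).
Proof.
rewrite -lecR -cmodE; apply: le_trans (ler_norm_sum _ _ _) _.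
by rewrite rmorph_sum; apply: ler_sum => i _; rewrite cmodE.
Qed.

Let F_integrable : mu.-integrable [set: T] (EFin \o F).
Proof.
apply: (@integrable_le _ _ _ _ _ (fun x => #|I|%:R ^+ (2 * k) * D x)).
- exact/measurable_cmod_pow/cmeasurable_sum.
- move=> x; rewrite ger0_norm ?exprn_ge0 ?cmod_ge0//.
  apply: le_trans (sum_cmod_pow_le x).
  by rewrite lerXn2r ?nnegrE ?cmod_ge0 ?cmod_sum ?sumr_ge0// => i _; exact: cmod_ge0.
- exact: integrable_scale.
Qed.

Let S_integrable : mu.-integrable [set: T] (EFin \o S).
Proof.
have sumsq_ge0 x : 0 <= \sum_i cmod (dd i x) ^+ 2.
  by rewrite sumr_ge0// => i _; exact: sqr_ge0.
apply: (@integrable_le _ _ _ _ _ (fun x => #|I|%:R ^+ (2 * k) * D x)).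
- rewrite /S; under eq_fun do rewrite exprM sqr_sqrtr//.
  by apply/measurable_funX/measurable_sum => i; exact: measurable_cmod_sqr.
- move=> x; rewrite ger0_norm ?exprn_ge0 ?sqrtr_ge0//.
  apply: le_trans (sum_cmod_pow_le x).
  have s0 : 0 <= \sum_i cmod (dd i x) by rewrite sumr_ge0// => i _; exact: cmod_ge0.
  rewrite lerXn2r ?nnegrE ?sqrtr_ge0//.
  (* The square function is at most the sum of the moduli: each squared modulus is at most that
     modulus times the full sum. *)
  rewrite -(ler_pXn2r (n := 2)) ?nnegrE ?sqrtr_ge0// sqr_sqrtr//.
  rewrite [leRHS]expr2 mulr_suml; apply: ler_sum => i _.
  rewrite expr2 ler_wpM2l ?cmod_ge0// (bigD1 i)//= lerDl.
  by rewrite sumr_ge0// => j _; exact: cmod_ge0.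
- exact: integrable_scale.
Qed.

Let alt_integrable (g : 'I_(2 * k) -> I) :
  mu.-integrable [set: T] (EFin \o (fun x => complex.Re (alt_prod dd g x))).
Proof.
apply: integrable_le D_integrable.
- suff [] : cmeasurable (alt_prod dd g) by [].
  apply: cmeasurable_prod => j; case: (odd j) => //=; exact: cmeasurable_conj.
- move=> x; apply: le_trans (Re_le_cmod _) _.
  rewrite (_ : cmod _ = \prod_j cmod (dd (g j) x)).
    by apply: (@prod_le_sum_pow _ _ (fun i => cmod (dd i x))) => // i; exact: cmod_ge0.
  apply: complexI; rewrite -cmodE normr_prod rmorph_prod.
  by apply: eq_bigr => j _; rewrite /= -cmodE; case: ifP; rewrite // cconjE norm_conjC.
Qed.

Let PE x : P x = \sum_(g : {ffun 'I_(2 * k) -> I} | injectiveb g)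
  complex.Re (alt_prod dd g x).
Proof. by rewrite /P raddf_sum. Qed.

Let P_integrable : mu.-integrable [set: T] (EFin \o P).
Proof.
rewrite (_ : P = fun x => \sum_(g : {ffun 'I_(2 * k) -> I} | injectiveb g)
  complex.Re (alt_prod dd g x)); last by apply/funext => x; exact: PE.
exact: integrable_sum_fin.
Qed.

Hypothesis dd_orth : p_orthogonal mu (2 * k) dd.

(** The one place where orthogonality enters, term by term over the injective maps. *)
Let Rintegral_P : (\int[mu]_x P x = 0)%R.
Proof.
under eq_Rintegral do rewrite PE.
rewrite Rintegral_sum_fin// big1// => g /injectiveP /dd_orth[Re0 _].
by rewrite /Rintegral Re0.
Qed.

(** Integrating [cmod_sum_pow_le] removes [P]; half of the finite integral of [F] is then absorbed
    on the left. *)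
Lemma Rintegral_cmod_sum_le :
  (\int[mu]_x F x <= (2 * (2 * k))%:R ^+ (2 * k) * \int[mu]_x S x)%R.
Proof.
set c := _ ^+ _.
have cS := integrable_scale c S_integrable.
have FcS : mu.-integrable [set: T] (EFin \o (fun x => F x + c * S x)).
  exact: (integrableD measurableT F_integrable cS).
have hFS := integrable_scale 2^-1 FcS.
have FP : mu.-integrable [set: T] (EFin \o (fun x => F x - P x)).
  exact: (integrableB measurableT F_integrable P_integrable).
have : (\int[mu]_x (F x - P x) <= \int[mu]_x (2^-1 * (F x + c * S x)))%R.
  apply: le_Rintegral => // x _; rewrite /S /c -exprMn.
  exact: cmod_sum_pow_le.
rewrite RintegralB// Rintegral_P RintegralZl// RintegralD// RintegralZl//.
lra.
Qed.

Lemma Rintegral_square_fun_le :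
  (\int[mu]_x S x <= 2 * ((2 * k)`!%:R * (2 * (2 * k)`!)%:R ^+ (2 * k)) *
     (\int[mu]_x F x + \sum_i \int[mu]_x (cmod (dd i x) ^+ (2 * k))))%R.
Proof.
set c := (_`!%:R * _).
have hS := integrable_scale 2^-1 S_integrable.
have sP := integrable_scale ((-1) ^+ k) P_integrable.
have SP : mu.-integrable [set: T] (EFin \o (fun x => 2^-1 * S x - (-1) ^+ k * P x)).
  exact: (integrableB measurableT hS sP).
have FD : mu.-integrable [set: T] (EFin \o (fun x => F x + D x)).
  exact: (integrableD measurableT F_integrable D_integrable).
have cFD := integrable_scale c FD.
have : (\int[mu]_x (2^-1 * S x - (-1) ^+ k * P x) <= \int[mu]_x (c * (F x + D x)))%R.
  apply: le_Rintegral => // x _; exact: square_fun_pow_le.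
rewrite RintegralB// !RintegralZl// Rintegral_P RintegralD//.
rewrite (Rintegral_sum_fin _ integrable_cmod_pow).
lra.
Qed.

Lemma cLnorm_family i : cLnorm mu (2 * k)%:R (dd i) =
  ((\int[mu]_x (cmod (dd i x) ^+ (2 * k)))%R `^ (2 * k)%:R^-1)%:E.
Proof. by rewrite cLnormE -EFin_Rintegral ?poweR_EFin//; exact: integrable_cmod_pow. Qed.

Lemma cLnorm_sum : cLnorm mu (2 * k)%:R (fun x => \sum_i dd i x) =
  ((\int[mu]_x F x)%R `^ (2 * k)%:R^-1)%:E.
Proof. by rewrite cLnormE -EFin_Rintegral ?poweR_EFin. Qed.

Lemma cLnorm_sqfun : cLnorm mu (2 * k)%:R (sqfun dd) =
  ((\int[mu]_x S x)%R `^ (2 * k)%:R^-1)%:E.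
Proof.
rewrite cLnormE.
under eq_integral do rewrite /sqfun /cmod /= expr0n addr0 sqr_sqrtr ?sumr_ge0//.
by rewrite -EFin_Rintegral ?poweR_EFin.
Qed.

End POrthogonal.

(** * From integrals to norms *)

Lemma powR_inv_add_le (R : realType) (n : nat) (x y : R) : (0 < n)%N ->
  0 <= x -> 0 <= y -> (x + y) `^ n%:R^-1 <= x `^ n%:R^-1 + y `^ n%:R^-1.
Proof.
move=> n0 x0 y0.
have nV : n%:R^-1 * n%:R = 1 :> R by rewrite mulVf// pnatr_eq0 -lt0n.
have powK (z : R) : 0 <= z -> (z `^ n%:R^-1) ^+ n = z.
  by move=> z0; rewrite -powR_mulrn ?powR_ge0// -powRrM nV powRr1.
rewrite -(ler_pXn2r n0) ?nnegrE ?addr_ge0 ?powR_ge0//.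
rewrite powK ?addr_ge0// -{1}(powK x)// -{1}(powK y)//.
move: (x `^ _) (y `^ _) (powR_ge0 x n%:R^-1) (powR_ge0 y n%:R^-1) => a b a0 b0.
(* It remains to see that [a ^+ n.+1 + b ^+ n.+1 <= (a + b) ^+ n.+1]: split off one factor [a + b]
   and bound [a] and [b] by it in the remaining powers. *)
case: n n0 {nV powK} => // n _; rewrite !exprS mulrDl.
by apply: lerD; rewrite ler_wpM2l// lerXn2r ?nnegrE ?addr_ge0// (lerDl, lerDr).
Qed.

Lemma p_orthogonal_sum_bounds (R : realType) (k : nat) (hk : (1 <= k)%N) :
  exists A : R, 0 < A /\ A <= 1 /\
  forall (d : measure_display) (T : measurableType d)
         (mu : {measure set T -> \bar R}) (I : finType) (dd : I -> T -> R[i]),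
    (forall i, inLp mu (2 * k)%:R (dd i)) ->
    p_orthogonal mu (2 * k) dd ->
    let p : R := (2 * k)%:R in
    ((A%:E * cLnorm mu p (sqfun dd)
       - (\sum_(i : I) cLnorm mu p (dd i) `^ p) `^ p^-1
      <= cLnorm mu p (fun x => (\sum_(i : I) dd i x)%R))%E /\
     (cLnorm mu p (fun x => (\sum_(i : I) dd i x)%R)
      <= (2 * p)%:E * cLnorm mu p (sqfun dd))%E).
Proof.
(* The constant of [Rintegral_square_fun_le]; the inverse of its root of order [2 * k] serves as
   [A], and [1 <= c] makes it at most 1. *)
pose c : R := 2 * ((2 * k)`!%:R * (2 * (2 * k)`!)%:R ^+ (2 * k)).
have p_gt0 : (0 < 2 * k)%N by rewrite muln_gt0.
have c1 : 1 <= c.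
  by rewrite /c !mulr_ege1 ?exprn_ege1 ?ler1n ?muln_gt0 ?fact_gt0.
have r1 : 1 <= c `^ (2 * k)%:R^-1.
  by rewrite -[leLHS](powRr0 c) ler_powR// invr_ge0.
have r0 : 0 < c `^ (2 * k)%:R^-1 by apply: lt_le_trans r1.
exists (c `^ (2 * k)%:R^-1)^-1; split; first by rewrite invr_gt0.
split; first by rewrite invf_le1.
move=> d T mu I dd dd_Lp dd_orth p.
have pV : p != 0 by rewrite pnatr_eq0 -lt0n.
have F0 : (0 <= \int[mu]_x (cmod (\sum_i dd i x) ^+ (2 * k)))%R.
  by apply: Rintegral_ge0 => x _; rewrite exprn_ge0 ?cmod_ge0.
have S0 : (0 <= \int[mu]_x (Num.sqrt (\sum_i cmod (dd i x) ^+ 2) ^+ (2 * k)))%R.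
  by apply: Rintegral_ge0 => x _; rewrite exprn_ge0 ?sqrtr_ge0.
have D0 i : (0 <= \int[mu]_x (cmod (dd i x) ^+ (2 * k)))%R.
  by apply: Rintegral_ge0 => x _; rewrite exprn_ge0 ?cmod_ge0.
have powRp (z : R) : 0 <= z -> (z `^ p^-1) `^ p = z.
  by move=> z0; rewrite -powRrM mulVf// powRr1.
rewrite (cLnorm_sum hk dd_Lp) (cLnorm_sqfun hk dd_Lp).
under eq_bigr do rewrite (cLnorm_family hk dd_Lp) poweR_EFin powRp//.
rewrite sumEFin poweR_EFin -!EFinM -EFinB !lee_fin; split.
  rewrite lerBlDr ler_pdivrMl//.
  have c0 : 0 <= c by rewrite (le_trans ler01).
  have sumD0 : 0 <= \sum_i (\int[mu]_x (cmod (dd i x) ^+ (2 * k)))%R.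
    by rewrite sumr_ge0.
  (* Subadditivity of the root separates the norm of the sum from the sum of the individual
     norms. *)
  apply: le_trans (ler_wpM2l (ltW r0) (powR_inv_add_le p_gt0 F0 sumD0)).
  rewrite -powRM ?addr_ge0//; apply: ge0_ler_powR.
  - by rewrite invr_ge0.
  - by rewrite nnegrE.
  - by rewrite nnegrE mulr_ge0 ?addr_ge0.
  - exact: Rintegral_square_fun_le.
apply: le_trans (ge0_ler_powR _ _ _ (Rintegral_cmod_sum_le hk dd_Lp dd_orth)) _.
- by rewrite invr_ge0.
- by rewrite nnegrE.
- by rewrite nnegrE mulr_ge0 ?exprn_ge0.
(* The root turns the constant [(2 * p) ^+ (2 * k)] into [2 * p]. *)
rewrite powRM ?exprn_ge0// -powR_mulrn// -powRrM mulfV// powRr1//.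
by rewrite natrM.
Qed.

Theorem theorem2p1 (k : nat) (hk : (1 <= k)%N) :
  exists A : RR, 0 < A /\ A <= 1 /\
  forall (d : measure_display) (T : measurableType d)
         (mu : {measure set T -> \bar RR}) (I : finType) (dd : I -> T -> RR[i]),
    (forall i, inLp mu (2 * k)%:R (dd i)) ->
    p_orthogonal mu (2 * k) dd ->
    let p : RR := (2 * k)%:R in
    ((A%:E * cLnorm mu p (sqfun dd)
       - (\sum_(i : I) cLnorm mu p (dd i) `^ p) `^ p^-1
      <= cLnorm mu p (fun x => (\sum_(i : I) dd i x)%R))%E /\
     (cLnorm mu p (fun x => (\sum_(i : I) dd i x)%R)
      <= (2 * p)%:E * cLnorm mu p (sqfun dd))%E).
Proof. exact: p_orthogonal_sum_bounds. Qed.
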